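(* If $\mathbb{B}$ is a c.c.c. Boolean algebra, then $\langle\mathbb{B}^+,\ge,\mathbb{B}^+\rangle^\sigma\le_{\mathrm T}\mathbf{Part}^*(\mathbb{B})\le_{\mathrm T}\mathbf{Part}(\mathbb{B})$.
   Context: $\mathbb{B}^+=\mathbb{B}\setminus\{\mathbb0\}$. A relational system is a triple $\mathbf{A}=\langle A_-,A,A_+\rangle$ with $A\subseteq A_-\times A_+$. $\mathbf{A}^\sigma=\langle A_-,A^\sigma,{}^\omega A_+\rangle$ where $\langle a,f\rangle\in A^\sigma$ iff $\langle a,f(n)\rangle\in A$ for some $n<\omega$. A generalized Galois–Tukey connection from $\mathbf{A}$ to $\mathbf{B}$ is a pair $\varphi_-\colon A_-\to B_-$, $\varphi_+\colon B_+\to A_+$ with $\langle\varphi_-(a),b\rangle\in B\Rightarrow\langle a,\varphi_+(b)\rangle\in A$; $\mathbf{A}\le_{\mathrm T}\mathbf{B}$ means one exists. For c.c.c. $\mathbb{B}$, $\mathrm{Part}(\mathbb{B})$ is the set of maximal antichains of $\mathbb{B}^+$. For $A,B\in\mathrm{Part}(\mathbb{B})$: $A\le B$ if every $b\in B$ lies below some $a\in A$; for finite $F\subseteq A$, $A^F=(A\setminus F)\cup\{\bigvee F\}$; $A\le^*B$ if $A^F\le B$ for some finite $F\subseteq A$. $\mathbf{Part}(\mathbb{B})=\langle\mathrm{Part}(\mathbb{B}),\le,\mathrm{Part}(\mathbb{B})\rangle$, $\mathbf{Part}^*(\mathbb{B})=\langle\mathrm{Part}(\mathbb{B}),\le^*,\mathrm{Part}(\mathbb{B})\rangle$.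 *)

(* Defs.v *)
From HB Require Import structures.
From mathcomp Require Import all_boot all_order finmap.
From mathcomp Require Import boolp classical_sets functions cardinality.

Set Implicit Arguments.
Unset Strict Implicit.
Unset Printing Implicit Defensive.

Local Open Scope classical_set_scope.

Record relSystem := RelSystem {
  rs_minus : Type;
  rs_plus : Type;
  rs_rel : rs_minus -> rs_plus -> Prop }.

Definition rs_sigma (A : relSystem) : relSystem :=
  @RelSystem (rs_minus A) (nat -> rs_plus A)
    (fun a f => exists n, rs_rel a (f n)).

Definition is_GT_connection (A B : relSystem)
    (phim : rs_minus A -> rs_minus B) (phip : rs_plus B -> rs_plus A) : Prop :=
  forall (a : rs_minus A) (b : rs_plus B),
    rs_rel (phim a) b -> rs_rel a (phip b).

Definition Tukey_le (A B : relSystem) : Prop :=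
  exists (phim : rs_minus A -> rs_minus B) (phip : rs_plus B -> rs_plus A),
    is_GT_connection phim phip.

Section BooleanAlgebra.
Context {d : Order.disp_t} (B : ctbDistrLatticeType d).

Definition nonzero : Type := {b : B | b != \bot%O}.

Definition nonzero_ge_system : relSystem :=
  @RelSystem nonzero nonzero (fun a b => (sval b <= sval a)%O).

Definition antichain (A : set B) : Prop :=
  (forall a, A a -> a != \bot%O) /\
  (forall a b, A a -> A b -> a != b -> Order.meet a b = \bot%O).

Definition ccc : Prop := forall A : set B, antichain A -> countable A.

Definition maximal_antichain (A : set B) : Prop :=
  antichain A /\ forall A' : set B, antichain A' -> A `<=` A' -> A' = A.

Definition Part : Type := {A : set B | maximal_antichain A}.

(* Stated for arbitrary subsets, since merge A F below contains \bot when
   F is empty and is then not a partition. *)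
Definition refines (A A' : set B) : Prop :=
  forall b, A' b -> exists2 a, A a & (b <= a)%O.

(* The set written A^F in the mathematics. *)
Definition merge (A : set B) (F : {fset B}) : set B :=
  (A `\` [set` F]) `|` [set (\join_(x <- F) x)%O].

Definition almost_refines (A A' : set B) : Prop :=
  exists F : {fset B}, [set` F] `<=` A /\ refines (merge A F) A'.

Definition Part_system : relSystem :=
  @RelSystem Part Part (fun A A' => refines (sval A) (sval A')).

Definition Part_star_system : relSystem :=
  @RelSystem Part Part (fun A A' => almost_refines (sval A) (sval A')).

End BooleanAlgebra.

(* Main.v *)
Require Import Defs.
From HB Require Import structures.
From mathcomp Require Import all_boot all_order finmap.
From mathcomp Require Import boolp classical_sets functions cardinality.

(** For the first inequality send a partition [Q] to an enumeration of [Q]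
    together with all atoms; the latter are pairwise disjoint, hence countably
    many by c.c.c.  If [a] bounds an atom there is nothing to do.  Otherwise
    there is an infinite strictly descending sequence below [a], whose
    consecutive differences form an infinite antichain below [a]; send [a] to a
    maximal antichain [P] containing it.  If [P^F] is refined by [Q] for a
    finite [F], choose one of these differences [p] outside [F] and [q] in [Q]
    meeting [p]; the only member of [P^F] that meets [p] is [p] itself, so
    [q <= p <= a].  The second inequality is witnessed by identity maps, with
    [F] empty. *)

Local Open Scope classical_set_scope.
Local Open Scope order_scope.
Import Order.Theory.

(** The point [x0] excludes the empty set, the one countable set that no sequence enumerates. *)
Lemma countable_enum (T : Type) (A : set T) (x0 : T) :
  countable A -> A x0 ->
  exists f : nat -> T, (forall n, A (f n)) /\ forall x, A x -> exists n, f n = x.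
Proof.
move=> /pfcard_geP[-> //|[g]] _; exists g; split=> [n|x Ax].
  exact: (@funS _ _ _ _ g n I).
by have [n _ <-] := @surj _ _ _ _ g x Ax; exists n.
Qed.

Lemma injective_notin_fset (T : choiceType) (u : nat -> T) (F : {fset T}) :
  injective u -> exists n, u n \notin F.
Proof.
move=> u_inj; apply: contrapT => noF.
have uF n : u n \in F by apply: contrapT => /negP nF; apply: noF; exists n.
(* Pigeonhole: the first [(size F).+1] values of [u] would be distinct members of [F]. *)
have : (size (map u (iota 0 (size F).+1)) <= size F)%N.
  apply: uniq_leq_size; first by rewrite map_inj_uniq ?iota_uniq.
  by move=> _ /mapP[n _ ->]; exact: uF.
by rewrite size_map size_iota ltnn.
Qed.

Section Antichains.
Context {d : Order.disp_t} (B : ctbDistrLatticeType d).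
Implicit Types (A P Q : set B) (a b c p x : B).

Lemma antichain_extend A :
  antichain A -> exists2 P, maximal_antichain P & A `<=` P.
Proof.
move=> anti_A.
(* Zorn is applied to the sets that can be added to [A], not to the antichains containing [A]: the
   union of the empty chain, [set0], is then admissible. *)
have [C CS totC|X [anti_X maxX]] :=
    @Zorn_bigcup B [set X | antichain (A `|` X)].
  split=> [x [Ax|[X CX Xx]]|x y].
  - by have [nz _] := anti_A; exact: nz.
  - by have [nz _] := CS _ CX; apply: nz; right.
  have [_ disA] := anti_A.
  move=> [Ax|[X CX Xx]] [Ay|[Y CY Yy]].
  - exact: disA.
  - by have [_ dis] := CS _ CY; apply: dis; [left|right].
  - by have [_ dis] := CS _ CX; apply: dis; [right|left].
  have [XY|YX] := totC _ _ CX CY.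
  - by have [_ dis] := CS _ CY; apply: dis; right => //; exact: XY.
  - by have [_ dis] := CS _ CX; apply: dis; right => //; exact: YX.
exists (A `|` X); last by move=> x; left.
split=> // Y anti_Y sAXY; apply/seteqP; split=> // x Yx; right.
apply: contrapT => nXx; apply: (maxX Y).
  split=> [z Xz|]; first by apply: sAXY; right.
  by move=> sYX; exact/nXx/sYX.
by rewrite /= (iffRL (setUidPr A Y))// => z Az; apply: sAXY; left.
Qed.

(** Otherwise [x] could be added to [P], so by maximality [x] is in [P] and hence disjoint from
    itself. *)
Lemma maximal_antichain_meets P x :
  maximal_antichain P -> x != \bot -> exists2 p, P p & x `&` p != \bot.
Proof.
move=> [[nzP disP] maxP] nzx; apply: contrapT => noP.
have dis p : P p -> x `&` p = \bot.
  by move=> Pp; apply/eqP; apply: contrapT => /negP nz; apply: noP; exists p.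
have Px : P x.
  rewrite -(maxP (x |` P)); [by left| |by move=> y; right].
  split=> [y [->//|]|y z]; first exact: nzP.
  move=> [->|Py] [->|Pz]; rewrite ?eqxx// => neq.
  - exact: dis.
  - by rewrite meetC; exact: dis.
  - exact: disP.
by move: nzx; rewrite -(meetxx x) dis// eqxx.
Qed.

Definition is_atom a : Prop :=
  a != \bot /\ forall x, x <= a -> x = \bot \/ x = a.

Lemma atoms_antichain : antichain [set a | is_atom a].
Proof.
split=> [a []//|a b [_ atom_a] [_ atom_b] neq].
have [//|ab] := atom_a _ (leIl a b).
have [//|ba] := atom_b _ (leIr b a).
by move: neq; rewrite -ab ba eqxx.
Qed.

Lemma atomless_antichain a : a != \bot ->
  (forall c, is_atom c -> ~ c <= a) ->
  exists u : nat -> B,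
    [/\ injective u, antichain (range u) & forall n, u n <= a].
Proof.
move=> nza noatom.
(* The conditions on [b] stand under the quantifier so that [s] is total. A nonzero [b] below [a]
   with no smaller nonzero element would be an atom. *)
have /choice[s sP] b : exists c, b != \bot -> b <= a -> c < b /\ c != \bot.
  apply: contrapT => noc; apply: (noatom b).
  - split=> [|x xb]; first by apply/negP => /eqP b0; apply: noc; exists b;
      rewrite b0 eqxx.
    apply: contrapT => /not_orP[/eqP nzx /eqP neq].
    by apply: noc; exists x => _ _; rewrite lt_neqAle neq xb.
  - by apply: contrapT => nba; apply: noc; exists b.
pose t n := iter n s a.
have tP n : t n != \bot /\ t n <= a.
  elim: n => [|n [nz le]]; first by [].
  have [lt nz'] := sP _ nz le; split=> //.
  exact: le_trans (ltW lt) le.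
have t_lt n : t n.+1 < t n by have [nz le] := tP n; case: (sP _ nz le).
have t_le m n : (m <= n)%N -> t n <= t m.
  move=> /subnK<-; elim: (n - m)%N => // k; apply: le_trans.
  exact/ltW/t_lt.
pose u n := t n `\` t n.+1.
have u_nz n : u n != \bot.
  by rewrite /u diff_eq0 lt_geF.
(* [u n] lies below [t n], hence below [t m.+1], which was removed from [t m] to form [u m]. *)
have u_disl m n : (m < n)%N -> u m `&` u n = \bot.
  move=> mn; apply/eqP; rewrite -lex0 -(diffIK (t m) (t m.+1)).
  by rewrite leI2// (le_trans (leBx _ _))// t_le.
have u_dis m n : m != n -> u m `&` u n = \bot.
  by rewrite neq_ltn => /orP[]/u_disl//; rewrite meetC.
exists u; split=> [m n umn||n].
- apply/eqP; apply: contraT => /u_dis.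
  by rewrite umn meetxx => /eqP; rewrite (negPf (u_nz n)).
- split=> [_ [n _ <-]//|_ _ [m _ <-] [n _ <-] neq].
  by apply: u_dis; apply: contraNneq neq => ->.
- by apply: le_trans (leBx _ _) _; case: (tP n).
Qed.

Lemma almost_refines_below P Q (F : {fset B}) p :
  antichain P -> maximal_antichain Q -> [set` F] `<=` P ->
  refines (Defs.merge P F) Q -> P p -> p \notin F ->
  exists2 q, Q q & q <= p.
Proof.
move=> [nzP disP] maxQ sFP refPQ Pp pF.
have [q Qq pq] := maximal_antichain_meets _ _ maxQ (nzP _ Pp).
exists q => //; have [r mr qr] := refPQ q Qq.
have pr : p `&` r != \bot.
  by apply: contraNneq pq => pr0; rewrite -lex0 -pr0 leI2.
case: mr => [[Pr _]|rE].
  have [-> //|neq] := eqVneq p r.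
  by rewrite disP ?eqxx in pr.
(* Each member of [F] differs from [p], so it lies below the complement of [p]; hence so does their
   join. *)
case/negP: pr; rewrite rE meetC disj_leC.
apply/joinsP_seq => x xF _; rewrite -disj_leC disP//; first exact: sFP.
by apply: contraNneq pF => <-.
Qed.

Lemma part_sees_below a : a != \bot ->
  exists P : Part B, forall Q : Part B, almost_refines (sval P) (sval Q) ->
    exists2 x, (sval Q `|` [set c | is_atom c]) x & x <= a.
Proof.
move=> nza; have [[c [atom_c ca]]|noatom] :=
  pselect (exists c, is_atom c /\ c <= a).
  (* Any partition will do, since the atom [c] is available for every [Q]. *)
  have [|P maxP _] := antichain_extend set0; first by split.
  by exists (exist _ P maxP) => Q _; exists c => //; right.
have [c atom_c ca|u [u_inj u_anti ua]] := @atomless_antichain a nza.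
  by apply: noatom; exists c.
have [P maxP sP] := antichain_extend _ u_anti.
exists (exist _ P maxP) => -[Q maxQ] /= [F [sFP refPQ]].
have [n nF] := injective_notin_fset _ u F u_inj.
have Pu : P (u n) by apply: sP; exists n.
have [q Qq qu] := almost_refines_below _ _ _ _ maxP.1 maxQ sFP refPQ Pu nF.
by exists q; [left|exact: le_trans qu (ua n)].
Qed.

Lemma part_atoms_enum (Q : Part B) : (\bot : B) <> \top -> ccc B ->
  exists f : nat -> nonzero B,
    forall x, (sval Q `|` [set c | is_atom c]) x -> exists n, sval (f n) = x.
Proof.
move=> nontriv cccB; case: Q => Q maxQ /=.
(* [Q] is inhabited because some member of it must meet [\top]. *)
have nz1 : (\top : B) != \bot by apply/eqP => /esym.
have [q0 Qq0 _] := maximal_antichain_meets _ _ maxQ nz1.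
have cQ : countable (Q `|` [set c | is_atom c]).
  rewrite -bigcup2E; apply: bigcup_countable => // -[|[|n]] _ /=.
  - exact/cccB/maxQ.1.
  - exact/cccB/atoms_antichain.
  - exact: countable0.
have [f [fA f_surj]] := countable_enum _ _ q0 cQ (or_introl Qq0).
have nzf n : f n != \bot by case: (fA n) => [/maxQ.1.1|[]].
by exists (fun n => exist _ (f n) (nzf n)).
Qed.

End Antichains.

Theorem theorem3p8 (d : Order.disp_t) (B : ctbDistrLatticeType d)
    (B_nontrivial : (\bot : B)%O <> (\top)%O) (B_ccc : ccc B) :
  Tukey_le (rs_sigma (nonzero_ge_system B)) (Part_star_system B) /\
  Tukey_le (Part_star_system B) (Part_system B).
Proof.
split.
  have /choice[phim phimP] (a : nonzero B) :=
    part_sees_below B (sval a) (svalP a).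
  have /choice[phip phipP] Q := part_atoms_enum B Q B_nontrivial B_ccc.
  exists phim, phip => a Q /phimP[x Qx xa].
  by have [n fn] := phipP Q x Qx; exists n; rewrite /= fn.
(* Merging the empty family keeps every member of [P] and adds only [\bot]. *)
exists id, id => P Q /= PQ; exists fset0; split=> [x|x Qx].
  by rewrite /= in_fset0.
have [p Pp xp] := PQ x Qx; by exists p => //; left; split.
Qed.
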